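(* Let $\gamma$ be a Jordan curve which is a locally analytic curve; that is, let $T>0$ and let $\gamma:\mathbb{R}\to\mathbb{C}$ be a continuous $T$-periodic function which is injective on $[0,T)$ and which is locally analytic on $\mathbb{R}$. Then $\gamma$ is an analytic Jordan curve: there exist $0<r_1<1<r_2<+\infty$ and an injective holomorphic function $F:\{z\in\mathbb{C}: r_1<|z|<r_2\}\to\mathbb{C}$ such that $\gamma(\mathbb{R})=F(\mathbb{T})$, where $\mathbb{T}=\{z\in\mathbb{C}:|z|=1\}$.
   Context: A conformal mapping on an open set $V\subset\mathbb{C}$ is an injective holomorphic function $V\to\mathbb{C}$. Analytic curve: for real $a<b$, a continuous map $\gamma:[a,b]\to\mathbb{C}$ is an analytic curve if there exist an open set $V\subset\mathbb{C}$ containing $[a,b]$ and a conformal mapping $\phi:V\to\mathbb{C}$ with $\phi|_{[a,b]}=\gamma$. Locally analytic curve on $\mathbb{R}$: a continuous map $\gamma:\mathbb{R}\to\mathbb{C}$ is locally analytic if for every $t_0\in\mathbb{R}$ there exist real $a<t_0<b$ such that $\gamma|_{[a,b]}$ is an analytic curve. A Jordan curve is regarded here as a periodic function with domain $\mathbb{R}$, injective on a half-open period interval. *)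

(* Defs.v *)
From Stdlib Require Import Reals.
From Coquelicot Require Import Coquelicot.

Open Scope R_scope.

Definition holomorphic_on (V : C -> Prop) (f : C -> C) : Prop :=
  forall z : C, V z -> ex_derive (K := C_AbsRing) (V := C_NormedModule) f z.

Definition injective_on {A B : Type} (D : A -> Prop) (f : A -> B) : Prop :=
  forall x y : A, D x -> D y -> f x = f y -> x = y.

(* Maps defined on a subset are represented by total functions; every notion
   below depends only on the values on the given subset.  In particular
   [ex_derive f z] at a point [z] of an open set [V] depends only on [f] on [V]. *)
Definition conformal_on (V : C -> Prop) (f : C -> C) : Prop :=
  holomorphic_on V f /\ injective_on V f.

Definition analytic_curve (a b : R) (g : R -> C) : Prop :=
  a < b /\
  continuous_on (fun t : R => a <= t <= b) g /\
  exists (V : C -> Prop) (phi : C -> C),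
    open V /\
    (forall t : R, a <= t <= b -> V (RtoC t)) /\
    conformal_on V phi /\
    (forall t : R, a <= t <= b -> phi (RtoC t) = g t).

Definition locally_analytic_curve (g : R -> C) : Prop :=
  (forall t : R, continuous g t) /\
  forall t0 : R, exists a b : R, a < t0 < b /\ analytic_curve a b g.

Definition Jordan_curve (T : R) (g : R -> C) : Prop :=
  0 < T /\
  (forall t : R, continuous g t) /\
  (forall t : R, g (t + T) = g t) /\
  injective_on (fun t : R => 0 <= t < T) g.

Definition annulus (r1 r2 : R) (z : C) : Prop := r1 < Cmod z < r2.

Definition analytic_Jordan_curve (g : R -> C) : Prop :=
  exists (r1 r2 : R) (F : C -> C),
    0 < r1 < 1 /\ 1 < r2 /\
    conformal_on (annulus r1 r2) F /\
    (forall w : C,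
       (exists t : R, g t = w) <-> (exists z : C, Cmod z = 1 /\ F z = w)).

(* Main.v *)
Require Import Defs.
From Stdlib Require Import Reals Lra Lia ZArith Classical ClassicalEpsilon.
From Coquelicot Require Import Coquelicot.

(** Near each real point [t], [gamma] is the restriction of an injective
    holomorphic map; by compactness of a period these local extensions [Phi t]
    all exist on squares of one common radius ([uniform_extension]).  Two of
    them agree on the real axis, hence off it ([identity_near_axis]), so that
    [G z = Phi (Re z) z] is holomorphic and [T]-periodic on a strip around the
    real axis and extends [gamma] ([strip_extension]).  A second compactness
    argument, over pairs of points of a period, shows that on a thinner strip
    [G] takes the same value only at points that differ by a multiple of [T]:
    for nearby points this is injectivity of [Phi t], for the others it is
    injectivity of [gamma] on a period and continuity
    ([injective_modulo_period]).  The change of variable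
    [w = exp (2 pi i z / T)] turns the strip into an annulus around the unit
    circle and [G] into an injective holomorphic function of [w]
    ([descend_along_cexp]).

    The one fact of function theory involved is uniqueness of the extension: a
    function [h] that is complex differentiable near a closed square and
    vanishes on its bottom side vanishes at its centre, say [0]
    ([square_center_vanish]).  Otherwise let
    [P w = h w * h (i w) * h (- w) * h (- i w)], normalised by [P 0 = 1].  It is
    invariant under [w |-> i w] and vanishes on the whole boundary of the
    square, because a quarter turn maps each side to the next.  For small [s]
    the square of half-width [S], minus that of half-width [s], is made of four
    rectangles that are quarter turns of [[-s, S] x [-S, -s]].  The integral of
    [P w / w] around this one rectangle is zero; its outer sides contribute
    nothing and, by the invariance, the two inner sides contribute minus the
    integral of [P w / w] from [- s - i s] to [s - i s].  Since [P] is close to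
    [1] there, the imaginary part of the integrand is positive: a
    contradiction.  This uses Cauchy's theorem for a rectangle only, in the
    form of Goursat ([goursat_rectangle]), as nothing is known about the
    continuity of the derivative. *)

(** * Goursat's theorem on a rectangle *)

(** The integral of [p dx + q dy] counterclockwise around the boundary of
    [[a, b] x [c, d]]. *)
Definition circulation (p q : R -> R -> R) (a b c d : R) : R :=
  RInt (fun x => p x c) a b + RInt (fun y => q b y) c d
  - RInt (fun x => p x d) a b - RInt (fun y => q a y) c d.

(** The two occurrences of [B] say that the cross derivatives [p_y] and [q_x]
    agree; the form is differentiable at the point, but its derivative need
    not be continuous. *)
Definition closed_form_at (p q : R -> R -> R) (x y : R) : Prop :=
  exists A B D, differentiable_pt_lim p x y A B /\ differentiable_pt_lim q x y B D.

Lemma is_RInt_affine (m n a b : R) :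
  is_RInt (fun x => m + n * x) a b (m * (b - a) + n * (b ^ 2 - a ^ 2) / 2).
Proof.
  replace (m * (b - a) + n * (b ^ 2 - a ^ 2) / 2)
    with (minus (m * b + n * b ^ 2 / 2) (m * a + n * a ^ 2 / 2))
    by (unfold minus, plus, opp; simpl; field).
  apply (is_RInt_derive (fun x => m * x + n * x ^ 2 / 2)).
  - intros x _. auto_derive; [easy | field].
  - intros x _. apply (continuous_plus (fun _ => m) (fun x => n * x)).
    + apply continuous_const.
    + apply (continuous_mult (fun _ => n) (fun x => x)).
      * apply continuous_const.
      * apply continuous_id.
Qed.

Lemma differentiable_continuous_l p x y l1 l2 :
  differentiable_pt_lim p x y l1 l2 -> continuous (fun t => p t y) x.
Proof.
  intros H.
  assert (C : continuity_2d_pt p x y)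
    by (apply differentiable_continuity_pt; exists l1, l2; exact H).
  apply continuity_2d_pt_filterlim in C.
  apply (continuous_comp_2 (fun t => t) (fun _ => y) p x).
  - apply continuous_id.
  - apply continuous_const.
  - exact C.
Qed.

Lemma differentiable_continuous_r p x y l1 l2 :
  differentiable_pt_lim p x y l1 l2 -> continuous (fun t => p x t) y.
Proof.
  intros H.
  assert (C : continuity_2d_pt p x y)
    by (apply differentiable_continuity_pt; exists l1, l2; exact H).
  apply continuity_2d_pt_filterlim in C.
  apply (continuous_comp_2 (fun _ => x) (fun t => t) p y).
  - apply continuous_const.
  - apply continuous_id.
  - exact C.
Qed.

Lemma ex_RInt_continuous_le (f : R -> R) a b :
  a <= b -> (forall x, a <= x <= b -> continuous f x) -> ex_RInt f a b.
Proof.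
  intros Hab Hf. apply (ex_RInt_continuous (V := R_CompleteNormedModule)).
  intros z. rewrite Rmin_left, Rmax_right by lra. apply Hf.
Qed.

Definition closed_form_on p q a b c d :=
  forall x y, a <= x <= b -> c <= y <= d -> closed_form_at p q x y.

Lemma closed_form_ex_RInt_p p q a b c d y a' b' :
  closed_form_on p q a b c d -> c <= y <= d -> a <= a' -> a' <= b' -> b' <= b ->
  ex_RInt (fun x => p x y) a' b'.
Proof.
  intros H Hy Ha Hab Hb. apply ex_RInt_continuous_le; [lra|].
  intros x Hx. destruct (H x y) as (A & B & D & Hp & _); [lra..|].
  eapply differentiable_continuous_l, Hp.
Qed.

Lemma closed_form_ex_RInt_q p q a b c d x c' d' :
  closed_form_on p q a b c d -> a <= x <= b -> c <= c' -> c' <= d' -> d' <= d ->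
  ex_RInt (fun y => q x y) c' d'.
Proof.
  intros H Hx Hc Hcd Hd. apply ex_RInt_continuous_le; [lra|].
  intros y Hy. destruct (H x y) as (A & B & D & _ & Hq); [lra..|].
  eapply differentiable_continuous_r, Hq.
Qed.

Lemma RInt_Chasles_R (f : R -> R) a b c :
  ex_RInt f a b -> ex_RInt f b c -> RInt f a c = RInt f a b + RInt f b c.
Proof. intros H1 H2. symmetry. exact (RInt_Chasles f a b c H1 H2). Qed.

(** Each inner edge is run through twice, in opposite directions. *)
Lemma circulation_quarters p q a b c d m n :
  closed_form_on p q a b c d -> a <= m <= b -> c <= n <= d ->
  circulation p q a b c d =
  circulation p q a m c n + circulation p q m b c n
  + circulation p q a m n d + circulation p q m b n d.
Proof.
  intros H Hm Hn. unfold circulation.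
  assert (Sp : forall y, c <= y <= d ->
    RInt (fun x => p x y) a b = RInt (fun x => p x y) a m + RInt (fun x => p x y) m b).
  { intros y Hy. apply RInt_Chasles_R;
      apply (closed_form_ex_RInt_p p q a b c d y); assumption || lra. }
  assert (Sq : forall x, a <= x <= b ->
    RInt (fun y => q x y) c d = RInt (fun y => q x y) c n + RInt (fun y => q x y) n d).
  { intros x Hx. apply RInt_Chasles_R;
      apply (closed_form_ex_RInt_q p q a b c d x); assumption || lra. }
  rewrite !Sp, !Sq by lra. ring.
Qed.

(** The subtracted form has affine coefficients and equal cross derivatives, so
    it is exact and has no circulation. *)
Lemma circulation_sub_affine p q a b c d x0 y0 p0 q0 A B D :
  closed_form_on p q a b c d -> a <= b -> c <= d ->
  circulation p q a b c d =
  circulation (fun x y => p x y - p0 - (A * (x - x0) + B * (y - y0)))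
              (fun x y => q x y - q0 - (B * (x - x0) + D * (y - y0))) a b c d.
Proof.
  intros H Hab Hcd. unfold circulation.
  assert (Ip : forall y, c <= y <= d ->
    RInt (fun x => p x y - p0 - (A * (x - x0) + B * (y - y0))) a b =
    RInt (fun x => p x y) a b -
    ((p0 - A * x0 + B * (y - y0)) * (b - a) + A * (b ^ 2 - a ^ 2) / 2)).
  { intros y Hy. apply is_RInt_unique.
    eapply is_RInt_ext; [| apply (is_RInt_minus (V := R_NormedModule));
      [apply (RInt_correct (V := R_CompleteNormedModule)); apply (closed_form_ex_RInt_p p q a b c d y); assumption || lra
      | apply is_RInt_affine]].
    intros x _. unfold minus, plus, opp; simpl. ring. }
  assert (Iq : forall x, a <= x <= b ->
    RInt (fun y => q x y - q0 - (B * (x - x0) + D * (y - y0))) c d =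
    RInt (fun y => q x y) c d -
    ((q0 - D * y0 + B * (x - x0)) * (d - c) + D * (d ^ 2 - c ^ 2) / 2)).
  { intros x Hx. apply is_RInt_unique.
    eapply is_RInt_ext; [| apply (is_RInt_minus (V := R_NormedModule));
      [apply (RInt_correct (V := R_CompleteNormedModule)); apply (closed_form_ex_RInt_q p q a b c d x); assumption || lra
      | apply is_RInt_affine]].
    intros y _. unfold minus, plus, opp; simpl. ring. }
  rewrite !Ip, !Iq by lra. field.
Qed.

Lemma continuous_sub_affine (f : R -> R) (u v w t s : R) :
  continuous f t -> continuous (fun x => f x - u - (v * (x - s) + w)) t.
Proof.
  intros Hf.
  assert (L : continuous (fun x => u + (v * (x - s) + w)) t).
  { apply (ex_derive_continuous (fun x => u + (v * (x - s) + w))). auto_derive. easy. }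
  eapply continuous_ext; [| apply (continuous_minus (V := R_NormedModule)); [exact Hf | exact L]].
  intros x. unfold minus, plus, opp; simpl. ring.
Qed.

(** Once the first-order Taylor part at [(x0, y0)] is removed, the integrand is
    at most [eps / 2 * l], where [l = b - a + (d - c)], and the boundary has
    length [2 * l].  The bound is a square so that four
    quarters together are bounded by the same expression as the whole. *)
Lemma circulation_small p q x0 y0 :
  closed_form_at p q x0 y0 -> forall eps : posreal, exists delta : posreal,
  forall a b c d, a <= x0 <= b -> c <= y0 <= d -> b - a < delta -> d - c < delta ->
  closed_form_on p q a b c d ->
  Rabs (circulation p q a b c d) <= eps * (b - a + (d - c)) ^ 2.
Proof.
  intros (A & B & D & Hp & Hq) eps.
  assert (He : 0 < eps / 2) by (pose proof (cond_pos eps); lra).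
  destruct (Hp (mkposreal _ He)) as [d1 H1]. destruct (Hq (mkposreal _ He)) as [d2 H2].
  simpl in H1, H2.
  assert (Hd : 0 < Rmin d1 d2) by (apply Rmin_pos; apply cond_pos).
  exists (mkposreal _ Hd). simpl. intros a b c d Hx Hy Hw Hh H.
  pose proof (Rmin_l d1 d2). pose proof (Rmin_r d1 d2).
  rewrite (circulation_sub_affine p q a b c d x0 y0 (p x0 y0) (q x0 y0) A B D) by (assumption || lra).
  assert (Rab : forall x y, a <= x <= b -> c <= y <= d ->
            Rabs (x - x0) <= b - a /\ Rabs (y - y0) <= d - c).
  { intros x y ? ?. split; apply Rabs_le; lra. }
  set (M := eps / 2 * (b - a + (d - c))).
  assert (Mbound : forall x y, a <= x <= b -> c <= y <= d ->
     eps / 2 * Rmax (Rabs (x - x0)) (Rabs (y - y0)) <= M).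
  { intros x y h1 h2. destruct (Rab x y h1 h2). unfold M.
    apply Rmult_le_compat_l; [lra|]. apply Rmax_lub; lra. }
  assert (Bp : forall x y, a <= x <= b -> c <= y <= d ->
     Rabs (p x y - p x0 y0 - (A * (x - x0) + B * (y - y0))) <= M).
  { intros x y h1 h2. destruct (Rab x y h1 h2).
    eapply Rle_trans; [apply H1; lra | auto]. }
  assert (Bq : forall x y, a <= x <= b -> c <= y <= d ->
     Rabs (q x y - q x0 y0 - (B * (x - x0) + D * (y - y0))) <= M).
  { intros x y h1 h2. destruct (Rab x y h1 h2).
    eapply Rle_trans; [apply H2; lra | auto]. }
  assert (Ep : forall y, c <= y <= d ->
    Rabs (RInt (fun x => p x y - p x0 y0 - (A * (x - x0) + B * (y - y0))) a b) <= (b - a) * M).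
  { intros y h. apply abs_RInt_le_const; [lra | | auto].
    apply ex_RInt_continuous_le; [lra|]. intros x h'. apply continuous_sub_affine.
    destruct (H x y h' h) as (? & ? & ? & K & _). eapply differentiable_continuous_l, K. }
  assert (Eq : forall x, a <= x <= b ->
    Rabs (RInt (fun y => q x y - q x0 y0 - (B * (x - x0) + D * (y - y0))) c d) <= (d - c) * M).
  { intros x h. apply abs_RInt_le_const; [lra | | auto].
    apply ex_RInt_continuous_le; [lra|]. intros y h'.
    eapply continuous_ext; [| apply (continuous_sub_affine (q x) (q x0 y0) D (B * (x - x0)) y y0)].
    - intros t. simpl. ring.
    - destruct (H x y h h') as (? & ? & ? & _ & K). eapply differentiable_continuous_r, K. }
  unfold circulation.
  pose proof (Ep c ltac:(lra)) as E1. pose proof (Ep d ltac:(lra)) as E2.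
  pose proof (Eq a ltac:(lra)) as E3. pose proof (Eq b ltac:(lra)) as E4.
  apply Rle_trans with (2 * ((b - a) * M) + 2 * ((d - c) * M));
    [| right; unfold M; field].
  apply Rabs_le_between in E1. apply Rabs_le_between in E2.
  apply Rabs_le_between in E3. apply Rabs_le_between in E4.
  apply Rabs_le. lra.
Qed.

Lemma dependent_choice {A : Type} (Q : nat -> A -> Prop) (Rel : nat -> A -> A -> Prop) (a0 : A) :
  Q 0%nat a0 -> (forall n a, Q n a -> exists a', Q (S n) a' /\ Rel n a a') ->
  exists f : nat -> A, f 0%nat = a0 /\ forall n, Q n (f n) /\ Rel n (f n) (f (S n)).
Proof.
  intros H0 HS.
  set (f := nat_rect (fun _ => A) a0
     (fun n a => epsilon (inhabits a0) (fun a' => Q (S n) a' /\ Rel n a a'))).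
  assert (Hf : forall n, Q n (f n)).
  { induction n as [|n IH]; [exact H0|].
    exact (proj1 (epsilon_spec (inhabits a0) _ (HS n (f n) IH))). }
  exists f. split; [reflexivity|]. intros n. split; [apply Hf|].
  exact (proj2 (epsilon_spec (inhabits a0) _ (HS n (f n) (Hf n)))).
Qed.

Lemma nested_intervals (u v : nat -> R) :
  (forall n, u n <= u (S n)) -> (forall n, v (S n) <= v n) -> (forall n, u n <= v n) ->
  exists x, forall n, u n <= x <= v n.
Proof.
  intros Hu Hv Huv.
  assert (Mu : forall n k, u n <= u (k + n)%nat).
  { intros n. induction k as [|k IH]; simpl; [lra|]. eapply Rle_trans; [exact IH | apply Hu]. }
  assert (Mv : forall n k, v (k + n)%nat <= v n).
  { intros n. induction k as [|k IH]; simpl; [lra|]. eapply Rle_trans; [apply Hv | exact IH]. }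
  assert (Hle : forall m n, u m <= v n).
  { intros m n. eapply Rle_trans; [apply (Mu m n)|].
    eapply Rle_trans; [apply Huv|]. rewrite Nat.add_comm. apply Mv. }
  destruct (completeness (fun y => exists n, y = u n)) as [x [Hx1 Hx2]].
  - exists (v 0%nat). intros y [n ->]. apply Hle.
  - exists (u 0%nat), 0%nat. reflexivity.
  - exists x. intros n. split.
    + apply Hx1. now exists n.
    + apply Hx2. intros y [m ->]. apply Hle.
Qed.

Lemma half_pow_small (L delta : R) : 0 < delta -> exists n : nat, L / 2 ^ n < delta.
Proof.
  intros Hd.
  destruct (Pow_x_infinity 2) with (b := L / delta + 1) as [N HN];
    [rewrite Rabs_right; lra|].
  exists N. specialize (HN N (Nat.le_refl N)).
  assert (0 < 2 ^ N) by (apply pow_lt; lra).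
  rewrite Rabs_right in HN by lra.
  apply (Rmult_lt_reg_r (2 ^ N)); [assumption|].
  unfold Rdiv. rewrite Rmult_assoc, Rinv_l, Rmult_1_r by lra.
  apply (Rmult_ge_compat_l delta) in HN; [|lra].
  replace (delta * (L / delta + 1)) with (L + delta) in HN by (field; lra). lra.
Qed.

(** If the circulation is not zero, repeated quartering yields nested
    rectangles on which it decreases at most like [4 ^ (- n)]; at their common
    point this contradicts [circulation_small]. *)
Lemma goursat_rectangle p q a b c d :
  a <= b -> c <= d -> closed_form_on p q a b c d -> circulation p q a b c d = 0.
Proof.
  intros Hab Hcd H.
  destruct (Req_dec (circulation p q a b c d) 0) as [E|E]; [exact E|exfalso].
  set (K := Rabs (circulation p q a b c d)).
  assert (HK : 0 < K) by (apply Rabs_pos_lt; exact E).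
  set (w := fun n : nat => (b - a) / 2 ^ n). set (h := fun n : nat => (d - c) / 2 ^ n).
  assert (p2 : forall n, 0 < 2 ^ n) by (intros; apply pow_lt; lra).
  assert (Hw : forall n, w n = 2 * w (S n)) by (intros n; unfold w; simpl; field; specialize (p2 n); lra).
  assert (Hh : forall n, h n = 2 * h (S n)) by (intros n; unfold h; simpl; field; specialize (p2 n); lra).
  assert (w_pos : forall n, 0 <= w n).
  { intros n. unfold w. apply Rdiv_le_0_compat; [lra | apply p2]. }
  assert (h_pos : forall n, 0 <= h n).
  { intros n. unfold h. apply Rdiv_le_0_compat; [lra | apply p2]. }
  set (bad := fun n (z : R * R) =>
    a <= fst z /\ fst z + w n <= b /\ c <= snd z /\ snd z + h n <= d /\
    K / 4 ^ n <= Rabs (circulation p q (fst z) (fst z + w n) (snd z) (snd z + h n))).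
  (* A rectangle of the n-th generation is determined by its lower left corner. *)
  destruct (dependent_choice bad (fun n z z' =>
     fst z <= fst z' /\ fst z' + w (S n) <= fst z + w n /\
     snd z <= snd z' /\ snd z' + h (S n) <= snd z + h n) (a, c)) as (f & _ & Hf).
  { unfold bad, w, h. simpl. replace (a + (b - a) / 1) with b by field.
    replace (c + (d - c) / 1) with d by field. fold K. lra. }
  { intros n [x y] (B1 & B2 & B3 & B4 & B5). simpl in B1, B2, B3, B4, B5.
    pose proof (Hw n). pose proof (Hh n). pose proof (w_pos (S n)). pose proof (h_pos (S n)).
    rewrite (circulation_quarters p q x (x + w n) y (y + h n) (x + w (S n)) (y + h (S n))) in B5;
      [| intros ? ? ? ?; apply H; lra | lra | lra].
    replace (x + w n) with (x + w (S n) + w (S n)) in B5 by lra.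
    replace (y + h n) with (y + h (S n) + h (S n)) in B5 by lra.
    assert (K4 : K / 4 ^ n = 4 * (K / 4 ^ S n))
      by (simpl; field; apply pow_nonzero; lra).
    rewrite K4 in B5.
    assert (Hcase : forall x' y', (x' = x \/ x' = x + w (S n)) -> (y' = y \/ y' = y + h (S n)) ->
      K / 4 ^ S n <= Rabs (circulation p q x' (x' + w (S n)) y' (y' + h (S n))) ->
      exists a', bad (S n) a' /\
         (fst (x, y) <= fst a' /\ fst a' + w (S n) <= fst (x, y) + w n /\
          snd (x, y) <= snd a' /\ snd a' + h (S n) <= snd (x, y) + h n)).
    { intros x' y' Hx' Hy' HC. exists (x', y'). unfold bad. simpl fst. simpl snd.
      destruct Hx' as [-> | ->]; destruct Hy' as [-> | ->]; repeat split; lra || exact HC. }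
    destruct (Rle_dec (K / 4 ^ S n) (Rabs (circulation p q x (x + w (S n)) y (y + h (S n)))))
      as [?|N1]; [apply (Hcase x y); auto|].
    destruct (Rle_dec (K / 4 ^ S n) (Rabs (circulation p q (x + w (S n)) (x + w (S n) + w (S n)) y (y + h (S n)))))
      as [?|N2]; [apply (Hcase (x + w (S n)) y); auto|].
    destruct (Rle_dec (K / 4 ^ S n) (Rabs (circulation p q x (x + w (S n)) (y + h (S n)) (y + h (S n) + h (S n)))))
      as [?|N3]; [apply (Hcase x (y + h (S n))); auto|].
    destruct (Rle_dec (K / 4 ^ S n) (Rabs (circulation p q (x + w (S n)) (x + w (S n) + w (S n)) (y + h (S n)) (y + h (S n) + h (S n)))))
      as [?|N4]; [apply (Hcase (x + w (S n)) (y + h (S n))); auto|].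
    exfalso.
    match type of B5 with _ <= Rabs (?A + ?B + ?C + ?D) =>
      pose proof (Rabs_triang (A + B + C) D); pose proof (Rabs_triang (A + B) C);
      pose proof (Rabs_triang A B) end.
    lra. }
  destruct (nested_intervals (fun n => fst (f n)) (fun n => fst (f n) + w n)) as [X HX].
  { intros n. apply (Hf n). }
  { intros n. apply (Hf n). }
  { intros n. specialize (w_pos n). lra. }
  destruct (nested_intervals (fun n => snd (f n)) (fun n => snd (f n) + h n)) as [Y HY].
  { intros n. apply (Hf n). }
  { intros n. apply (Hf n). }
  { intros n. specialize (h_pos n). lra. }
  set (L := b - a + (d - c)).
  assert (HeK : 0 < K / (L ^ 2 + 1)) by (apply Rdiv_lt_0_compat; [exact HK | nra]).
  assert (Hc : closed_form_at p q X Y).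
  { destruct (Hf 0%nat) as [(B1 & B2 & B3 & B4 & _) _].
    specialize (HX 0%nat). specialize (HY 0%nat). simpl in HX, HY. apply H; lra. }
  destruct (circulation_small p q X Y Hc (mkposreal _ HeK)) as [delta Hdelta].
  destruct (half_pow_small L delta (cond_pos delta)) as [n Hn].
  destruct (Hf n) as [(B1 & B2 & B3 & B4 & B5) _].
  assert (HL : L / 2 ^ n = w n + h n)
    by (unfold L, w, h; field; specialize (p2 n); lra).
  pose proof (w_pos n). pose proof (h_pos n).
  specialize (Hdelta (fst (f n)) (fst (f n) + w n) (snd (f n)) (snd (f n) + h n)
    (HX n) (HY n) ltac:(lra) ltac:(lra) ltac:(intros ? ? ? ?; apply H; lra)).
  pose proof (Rle_trans _ _ _ B5 Hdelta) as F. simpl pos in F.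
  replace (fst (f n) + w n - fst (f n) + (snd (f n) + h n - snd (f n)))
    with (L / 2 ^ n) in F by (rewrite HL; ring).
  assert (q4 : 4 ^ n = 2 ^ n * 2 ^ n) by (rewrite <- Rpow_mult_distr; f_equal; ring).
  rewrite q4 in F. specialize (p2 n). clear - F HK p2.
  assert (F2 : K <= K / (L ^ 2 + 1) * L ^ 2).
  { apply (Rmult_le_reg_r (/ (2 ^ n * 2 ^ n))); [apply Rinv_0_lt_compat; nra|].
    eapply Rle_trans; [exact F|]. right. field. split; nra. }
  assert (F3 : K / (L ^ 2 + 1) * L ^ 2 = K - K / (L ^ 2 + 1)) by (field; nra).
  assert (0 < K / (L ^ 2 + 1)) by (apply Rdiv_lt_0_compat; nra).
  lra.
Qed.

(** * Continuity and differentiability of complex functions *)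

Lemma continuous_C_pair {U : UniformSpace} (f g : U -> R) (x : U) :
  continuous f x -> continuous g x ->
  continuous (U := C_UniformSpace) (fun u => (f u, g u)) x.
Proof.
  intros Hf Hg. apply (continuous_comp_2 f g (fun a b => (a, b) : C) x Hf Hg).
  apply (continuous_ext (fun z : C => z)).
  - intros [a b]; reflexivity.
  - apply continuous_id.
Qed.

Lemma continuous_Re {U : UniformSpace} (f : U -> C) (x : U) :
  continuous (U := C_UniformSpace) f x -> continuous (fun u => fst (f u)) x.
Proof.
  intros Hf. apply (continuous_comp f (fun z : C => fst z)); [exact Hf|].
  destruct (f x). apply (continuous_fst (U := R_UniformSpace) (V := R_UniformSpace)).
Qed.

Lemma continuous_Im {U : UniformSpace} (f : U -> C) (x : U) :
  continuous (U := C_UniformSpace) f x -> continuous (fun u => snd (f u)) x.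
Proof.
  intros Hf. apply (continuous_comp f (fun z : C => snd z)); [exact Hf|].
  destruct (f x). apply (continuous_snd (U := R_UniformSpace) (V := R_UniformSpace)).
Qed.

Lemma continuous_Rmult {U : UniformSpace} (f g : U -> R) (x : U) :
  continuous f x -> continuous g x -> continuous (fun u => f u * g u) x.
Proof. apply (continuous_mult (K := R_AbsRing)). Qed.

Lemma continuous_Rplus {U : UniformSpace} (f g : U -> R) (x : U) :
  continuous f x -> continuous g x -> continuous (fun u => f u + g u) x.
Proof. apply (continuous_plus (V := R_NormedModule)). Qed.

Lemma continuous_Rminus {U : UniformSpace} (f g : U -> R) (x : U) :
  continuous f x -> continuous g x -> continuous (fun u => f u - g u) x.
Proof. apply (continuous_minus (V := R_NormedModule)). Qed.

Lemma continuous_Rdiv {U : UniformSpace} (f g : U -> R) (x : U) :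
  continuous f x -> continuous g x -> g x <> 0 -> continuous (fun u => f u / g u) x.
Proof.
  intros Hf Hg Hx. apply continuous_Rmult; [exact Hf|].
  apply (continuous_comp g Rinv); [exact Hg|]. now apply continuous_Rinv.
Qed.

Lemma continuous_Cplus {U : UniformSpace} (f g : U -> C) (x : U) :
  continuous (U := C_UniformSpace) f x -> continuous (U := C_UniformSpace) g x ->
  continuous (U := C_UniformSpace) (fun u => f u + g u)%C x.
Proof.
  intros Hf Hg. apply continuous_C_pair; apply continuous_Rplus;
    apply continuous_Re || apply continuous_Im; assumption.
Qed.

Lemma continuous_Cminus {U : UniformSpace} (f g : U -> C) (x : U) :
  continuous (U := C_UniformSpace) f x -> continuous (U := C_UniformSpace) g x ->
  continuous (U := C_UniformSpace) (fun u => f u - g u)%C x.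
Proof.
  intros Hf Hg. apply continuous_C_pair; apply continuous_Rminus;
    apply continuous_Re || apply continuous_Im; assumption.
Qed.

Lemma continuous_Cmult {U : UniformSpace} (f g : U -> C) (x : U) :
  continuous (U := C_UniformSpace) f x -> continuous (U := C_UniformSpace) g x ->
  continuous (U := C_UniformSpace) (fun u => f u * g u)%C x.
Proof.
  intros Hf Hg. apply continuous_C_pair.
  - apply continuous_Rminus; apply continuous_Rmult;
    apply continuous_Re || apply continuous_Im; assumption.
  - apply continuous_Rplus; apply continuous_Rmult;
    apply continuous_Re || apply continuous_Im; assumption.
Qed.

Lemma C_neq_0_normsq (z : C) : z <> 0%C -> fst z ^ 2 + snd z ^ 2 <> 0.
Proof.
  intros Hz E. apply Hz. destruct z as [a b]. simpl in E.
  assert (a = 0) by nra. assert (b = 0) by nra. now subst.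
Qed.

Lemma continuous_Cinv {U : UniformSpace} (f : U -> C) (x : U) :
  continuous (U := C_UniformSpace) f x -> f x <> 0%C ->
  continuous (U := C_UniformSpace) (fun u => / f u)%C x.
Proof.
  intros Hf Hx. pose proof (C_neq_0_normsq _ Hx) as Hn.
  pose proof (continuous_Re _ _ Hf) as HR. pose proof (continuous_Im _ _ Hf) as HI.
  apply continuous_C_pair; (apply continuous_Rdiv; [| | exact Hn]);
    repeat first [ exact HR | exact HI | apply continuous_Rplus | apply continuous_Rmult
                 | apply (continuous_opp (V := R_NormedModule)) | apply continuous_const ].
Qed.

Lemma Cminus_eq_0 (w z : C) : (w - z)%C = 0%C -> w = z.
Proof.
  intros E. replace w with ((w - z) + z)%C by ring. rewrite E. ring.
Qed.

Lemma Cdiff_quotient (a b w z : C) : w <> z -> a = (b + (a - b) / (w - z) * (w - z))%C.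
Proof. intros n. field. intros E. now apply n, Cminus_eq_0. Qed.

(** Caratheodory's form of differentiability: the difference quotient extends
    continuously to [z].  Unlike a limit of quotients it passes through
    products and compositions by substitution. *)
Definition cdiff (f : C -> C) (z : C) : Prop :=
  exists q : C -> C, continuous (T := C_UniformSpace) (U := C_UniformSpace) q z /\
    locally (T := C_UniformSpace) z (fun w => f w = f z + q w * (w - z))%C.

Lemma cdiff_continuous f z :
  cdiff f z -> continuous (T := C_UniformSpace) (U := C_UniformSpace) f z.
Proof.
  intros (q & Hq & Hf).
  apply (continuous_ext_loc (U := C_UniformSpace) _ (fun w => f z + q w * (w - z))%C).
  - revert Hf. apply filter_imp. intros w ->. reflexivity.
  - apply continuous_Cplus; [apply continuous_const|].
    apply continuous_Cmult; [exact Hq|].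
    apply continuous_Cminus; [apply continuous_id | apply continuous_const].
Qed.

Lemma ex_derive_iff_cdiff (f : C -> C) (z : C) :
  ex_derive (K := C_AbsRing) (V := C_NormedModule) f z <-> cdiff f z.
Proof.
  split.
  - intros [l [_ Hl]]. change C in l.
    specialize (Hl z (fun P H => H)).
    set (q := fun w => if excluded_middle_informative (w = z) then l else ((f w - f z) / (w - z))%C).
    exists q. split.
    + apply filterlim_locally. intros eps.
      assert (He : 0 < eps / 2) by (pose proof (cond_pos eps); lra).
      apply (locally_C z). generalize (Hl (mkposreal _ He)). apply filter_imp.
      intros w Hw. change C in w. simpl in Hw.
      apply (C_NormedModule_mixin_compat1 (q z) (q w)).
      change (Cmod (q w - q z) < eps).
      assert (qz : q z = l).
      { unfold q. destruct (excluded_middle_informative (z = z)); easy. }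
      rewrite qz. destruct (excluded_middle_informative (w = z)) as [->|n].
      * rewrite qz. replace (l - l)%C with (RtoC 0) by ring. rewrite Cmod_0. apply cond_pos.
      * assert (qw : q w = ((f w - f z) / (w - z))%C).
        { unfold q. destruct (excluded_middle_informative _) as [E|_]; [now elim n | reflexivity]. }
        rewrite qw.
        assert (Hn : (w - z)%C <> 0%C).
        { intros E. apply n. now apply Cminus_eq_0. }
        change (Cmod (f w - f z - (w - z) * l) <= eps / 2 * Cmod (w - z)) in Hw.
        replace ((f w - f z) / (w - z) - l)%C with ((f w - f z - (w - z) * l) / (w - z))%C
          by (field; exact Hn).
        rewrite Cmod_div by exact Hn.
        assert (0 < Cmod (w - z)) by (apply Cmod_gt_0; exact Hn).
        apply (Rmult_lt_reg_r (Cmod (w - z))); [assumption|].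
        unfold Rdiv. rewrite Rmult_assoc, Rinv_l, Rmult_1_r by lra.
        eapply Rle_lt_trans; [exact Hw|]. pose proof (cond_pos eps). nra.
    + apply filter_forall. intros w. change C in w.
      destruct (excluded_middle_informative (w = z)) as [->|n]; [ring|].
      replace (q w) with ((f w - f z) / (w - z))%C; [now apply Cdiff_quotient|].
      unfold q. destruct (excluded_middle_informative _) as [E|_]; [now elim n | reflexivity].
  - intros (q & Hq & Hf). exists (q z). split.
    + apply is_linear_scal_l.
    + intros x Hx.
      rewrite <- (is_filter_lim_locally_unique (V := AbsRing_NormedModule C_AbsRing) z x Hx).
      clear x Hx.
      intros eps. 
      assert (He : 0 < eps / sqrt 2).
      { apply Rdiv_lt_0_compat; [apply cond_pos | apply sqrt_lt_R0; lra]. }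
      apply (proj1 (filterlim_locally _ _)) with (eps := mkposreal _ He) in Hq.
      apply (locally_C z).
      generalize (filter_and _ _ Hq Hf). apply filter_imp. intros w [Hw ->].
      apply (C_NormedModule_mixin_compat2 (q z) (q w)) in Hw. simpl pos in Hw.
      change (Cmod (f z + q w * (w - z) - f z - (w - z) * q z) <= eps * Cmod (w - z)).
      replace (f z + q w * (w - z) - f z - (w - z) * q z)%C with ((q w - q z) * (w - z))%C by ring.
      rewrite Cmod_mult. apply Rmult_le_compat_r; [apply Cmod_ge_0|].
      change (Cmod (q w - q z) < sqrt 2 * (eps / sqrt 2)) in Hw.
      replace (sqrt 2 * (eps / sqrt 2)) with (pos eps) in Hw
        by (field; apply Rgt_not_eq, sqrt_lt_R0; lra).
      lra.
Qed.

Lemma cdiff_ext_loc f g z :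
  locally (T := C_UniformSpace) z (fun w => f w = g w) -> cdiff f z -> cdiff g z.
Proof.
  intros He (q & Hq & Hf). exists q. split; [exact Hq|].
  pose proof (locally_singleton _ _ He) as Ez. simpl in Ez.
  generalize (filter_and _ _ He Hf). apply filter_imp. intros w [Ew Fw].
  rewrite <- Ew, <- Ez. exact Fw.
Qed.

Lemma cdiff_affine a b z : cdiff (fun w => a + b * w)%C z.
Proof.
  exists (fun _ => b). split; [apply continuous_const|].
  apply filter_forall. intros w. ring.
Qed.

Lemma cdiff_minus f g z : cdiff f z -> cdiff g z -> cdiff (fun w => f w - g w)%C z.
Proof.
  intros (p & Hp & Hf) (q & Hq & Hg). exists (fun w => p w - q w)%C.
  split; [now apply continuous_Cminus|].
  generalize (filter_and _ _ Hf Hg). apply filter_imp. intros w [-> ->]. ring.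
Qed.

Lemma cdiff_mult f g z : cdiff f z -> cdiff g z -> cdiff (fun w => f w * g w)%C z.
Proof.
  intros Df Dg. pose proof (cdiff_continuous _ _ Dg) as Cg.
  destruct Df as (p & Hp & Hf), Dg as (q & Hq & Hg).
  exists (fun w => p w * g w + f z * q w)%C. split.
  - apply continuous_Cplus; apply continuous_Cmult; try assumption. apply continuous_const.
  - generalize (filter_and _ _ Hf Hg). apply filter_imp. intros w [-> Eg].
    rewrite Eg at 1. rewrite (Eg : g w = _). ring.
Qed.

Lemma cdiff_inv (z : C) : z <> 0%C -> cdiff (fun w => / w)%C z.
Proof.
  intros Hz. exists (fun w => - / (w * z))%C. split.
  - apply (continuous_ext (T := C_UniformSpace) (U := C_UniformSpace) (fun w => (0 - / (w * z))%C)).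
    { intros w. change (@eq C (0 - / (w * z))%C (- / (w * z))%C). ring. }
    apply continuous_Cminus; [apply continuous_const|].
    apply continuous_Cinv; [| apply Cmult_neq_0; exact Hz].
    apply continuous_Cmult; [apply continuous_id | apply continuous_const].
  - assert (O : locally (T := C_UniformSpace) z (fun w : C => w <> 0%C)).
    { pose proof (proj1 (Cmod_gt_0 z) Hz) as P0.
      apply (locally_C z). exists (mkposreal _ P0). intros w Hw E. subst w.
      change (Cmod (0 - z) < Cmod z) in Hw.
      replace (0 - z)%C with (- z)%C in Hw by ring. rewrite Cmod_opp in Hw. lra. }
    revert O. apply filter_imp. intros w Hw. field. split; [exact Hz | exact Hw].
Qed.

Lemma cdiff_comp (f g : C -> C) (z : C) :
  cdiff g z -> cdiff f (g z) -> cdiff (fun w => f (g w)) z.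
Proof.
  intros Dg (q & Hq & Hf). pose proof (cdiff_continuous _ _ Dg) as Cg.
  destruct Dg as (p & Hp & Hg).
  exists (fun w => q (g w) * p w)%C. split.
  - apply continuous_Cmult; [| exact Hp].
    apply (continuous_comp (U := C_UniformSpace) (V := C_UniformSpace) (W := C_UniformSpace)
             g q); assumption.
  - generalize (filter_and _ _ Hg (Cg _ Hf)). unfold filtermap. apply filter_imp.
    intros w [Ew ->]. rewrite Ew at 2. ring.
Qed.

Lemma cdiff_comp_affine f a b z :
  cdiff f (a + b * z)%C -> cdiff (fun w => f (a + b * w))%C z.
Proof. apply (cdiff_comp f (fun w => a + b * w)%C), cdiff_affine. Qed.

(** * Uniqueness of holomorphic extension from the real axis *)

(** The Cauchy-Riemann equations: the imaginary part of [f dz], which is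
    [Im f dx + Re f dy], is closed. *)
Lemma cdiff_closed_form (f : C -> C) (x y : R) :
  cdiff f (x, y) ->
  closed_form_at (fun a b => snd (f (a, b))) (fun a b => fst (f (a, b))) x y.
Proof.
  intros (q & Hq & Hf). set (l := q (x, y)).
  assert (Q : forall eps : posreal, locally_2d (fun a b =>
      f (a, b) = (f (x, y) + q (a, b) * ((a, b) - (x, y)))%C /\
      Rabs (fst (q (a, b)) - fst l) < eps / 2 /\
      Rabs (snd (q (a, b)) - snd l) < eps / 2) x y).
  { intros eps. apply locally_2d_locally.
    assert (He : 0 < eps / 2) by (pose proof (cond_pos eps); lra).
    apply (proj1 (filterlim_locally _ _)) with (eps := mkposreal _ He) in Hq.
    generalize (filter_and _ _ Hq Hf). apply filter_imp. intros [a b] [[h1 h2] h3].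
    split; [exact h3|]. split; [exact h1 | exact h2]. }
  assert (Est : forall (eps e1 e2 dx dy : R), Rabs e1 < eps / 2 -> Rabs e2 < eps / 2 ->
      Rabs (e1 * dx + e2 * dy) <= eps * Rmax (Rabs dx) (Rabs dy)).
  { intros eps e1 e2 dx dy h1 h2.
    pose proof (Rmax_l (Rabs dx) (Rabs dy)). pose proof (Rmax_r (Rabs dx) (Rabs dy)).
    pose proof (Rabs_pos dx). pose proof (Rabs_pos dy).
    pose proof (Rabs_pos e1). pose proof (Rabs_pos e2).
    eapply Rle_trans; [apply Rabs_triang|]. rewrite !Rabs_mult. nra. }
  exists (snd l), (fst l), (- snd l). split.
  - intros eps. generalize (Q eps). apply locally_2d_impl, locally_2d_forall.
    intros a b (E & h1 & h2). rewrite E.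
    replace (snd _ - _ - _) with
      ((snd (q (a, b)) - snd l) * (a - x) + (fst (q (a, b)) - fst l) * (b - y))
      by (simpl; ring).
    now apply Est.
  - intros eps. generalize (Q eps). apply locally_2d_impl, locally_2d_forall.
    intros a b (E & h1 & h2). rewrite E.
    replace (fst _ - _ - _) with
      ((fst (q (a, b)) - fst l) * (a - x) + (- (snd (q (a, b)) - snd l)) * (b - y))
      by (simpl; ring).
    apply Est; [exact h1 | now rewrite Rabs_Ropp].
Qed.

Lemma RInt_zero_ext (f : R -> R) a b : a <= b ->
  (forall x, a <= x <= b -> f x = 0) -> RInt f a b = 0.
Proof.
  intros Hab Hf. rewrite (RInt_ext f (fun _ => 0)).
  - rewrite RInt_const. unfold scal; simpl; unfold mult; simpl. ring.
  - intros x. rewrite Rmin_left, Rmax_right by lra. intros Hx. apply Hf. lra.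
Qed.

(** The form is the imaginary part of [P w / w dw], on the rectangle
    [[-s, S] x [-S, -s]], which avoids [0].  The bottom and right sides lie on
    the boundary of the large square, where [P] vanishes.  The quarter turn
    carries the left side to the part of the line [Im w = - s] with
    [s <= Re w <= S], where it cancels the corresponding part of the top
    side. *)
Lemma rotation_invariant_vanish (P : C -> C) (S : R) :
  0 < S ->
  (forall x y, Rabs x <= S -> Rabs y <= S -> cdiff P (x, y)) ->
  (forall w, P (Ci * w)%C = P w) ->
  (forall x, Rabs x <= S -> P (x, - S) = 0%C) ->
  P 0%C <> 1%C.
Proof.
  intros HS Hd Hrot Hbot H1.
  assert (Hloc : exists delta : posreal, forall x y, Rabs x < delta -> Rabs y < delta ->
     Rabs (fst (P (x, y)) - 1) < / 4 /\ Rabs (snd (P (x, y))) < / 4).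
  { assert (C0 : continuous (T := C_UniformSpace) (U := C_UniformSpace) P (0, 0)).
    { apply cdiff_continuous, Hd; rewrite Rabs_R0; lra. }
    assert (He : 0 < / 4) by lra.
    apply (proj1 (filterlim_locally _ _)) with (eps := mkposreal _ He) in C0.
    destruct C0 as [delta Hdelta]. exists delta. intros x y Hx Hy.
    destruct (Hdelta (x, y)) as [A1 A2].
    - split; [change (Rabs (x - 0) < delta) | change (Rabs (y - 0) < delta)];
        now rewrite Rminus_0_r.
    - change (P (0, 0)) with (P (RtoC 0)) in A1, A2. rewrite H1 in A1, A2.
      change (Rabs (snd (P (x, y)) - 0) < / 4) in A2. rewrite Rminus_0_r in A2.
      split; [exact A1 | exact A2]. }
  destruct Hloc as [delta Hdelta].
  set (s := Rmin S (delta / 2)).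
  pose proof (cond_pos delta) as Hdp.
  assert (Hs : 0 < s) by (apply Rmin_pos; lra).
  assert (HsS : s <= S) by apply Rmin_l.
  assert (Hsd : s <= delta / 2) by apply Rmin_r.
  set (k := fun w : C => (P w * / w)%C).
  set (u := fun x y => fst (k (x, y))). set (v := fun x y => snd (k (x, y))).
  assert (Hcl : closed_form_on v u (- s) S (- S) (- s)).
  { intros x y Hx Hy. apply cdiff_closed_form. apply cdiff_mult.
    - apply Hd; apply Rabs_le; lra.
    - apply cdiff_inv. intros E. injection E. lra. }
  pose proof (goursat_rectangle v u (- s) S (- S) (- s) ltac:(lra) ltac:(lra) Hcl) as G.
  unfold circulation in G.
  rewrite (RInt_zero_ext (fun x => v x (- S))) in G; [| lra |].
  2: { intros x Hx. unfold v, k. rewrite Hbot by (apply Rabs_le; lra). simpl. ring. }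
  rewrite (RInt_zero_ext (fun y => u S y)) in G; [| lra |].
  2: { intros y Hy. unfold u, k.
       replace (S, y) with (Ci * (y, (- S)%R))%C
         by (apply injective_projections; simpl; ring).
       rewrite Hrot, Hbot by (apply Rabs_le; lra). simpl. ring. }
  (* [- s + i y] is the image of [- y - i s] under multiplication by [- i]. *)
  assert (L : RInt (fun y => u (- s) y) (- S) (- s) = RInt (fun x => v x (- s)) S s).
  { pose proof (RInt_comp_lin (V := R_CompleteNormedModule)
      (fun x => v x (- s)) (-1) 0 (- S) (- s)) as RC.
    replace (-1 * (- S) + 0) with S in RC by ring.
    replace (-1 * (- s) + 0) with s in RC by ring.
    rewrite <- RC.
    - apply RInt_ext. intros y Hy. rewrite Rmin_left, Rmax_right in Hy by lra.
      unfold scal; simpl; unfold mult; simpl. unfold u, v, k.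
      replace (-1 * y + 0, - s) with (Ci * ((- s)%R, y))%C
        by (apply injective_projections; simpl; ring).
      rewrite Hrot. set (p := P (- s, y)). clearbody p. simpl. field. nra.
    - apply ex_RInt_swap. apply (closed_form_ex_RInt_p v u (- s) S (- S) (- s)); auto; lra. }
  assert (E1 : ex_RInt (fun x => v x (- s)) (- s) s)
    by (apply (closed_form_ex_RInt_p v u (- s) S (- S) (- s)); auto; lra).
  assert (E2 : ex_RInt (fun x => v x (- s)) s S)
    by (apply (closed_form_ex_RInt_p v u (- s) S (- S) (- s)); auto; lra).
  rewrite L, <- (opp_RInt_swap (V := R_CompleteNormedModule) (fun x => v x (- s)) s S) in G by exact E2.
  rewrite (RInt_Chasles_R (fun x => v x (- s)) (- s) s S E1 E2) in G.
  (* With [Re P] within 1/4 of 1 and [Im P] within 1/4 of 0, the numerator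
     [Im P * x + Re P * s] of [Im (P / w)] exceeds [3/4 s - 1/4 s]. *)
  assert (Pos : 0 < RInt (fun x => v x (- s)) (- s) s).
  { apply RInt_gt_0; [lra| |].
    - intros x Hx. unfold v, k.
      destruct (Hdelta x (- s)) as [h1 h2]; [apply Rabs_def1; lra..|].
      set (p := P (x, - s)) in *. clearbody p.
      apply Rabs_def2 in h1. apply Rabs_def2 in h2. simpl.
      replace (_ + _) with ((snd p * x + fst p * s) / (x * x + s * s)) by (field; nra).
      apply Rdiv_lt_0_compat; nra.
    - intros x Hx. destruct (Hcl x (- s)) as (? & ? & ? & K & _); [lra..|].
      eapply differentiable_continuous_l, K. }
  unfold opp in G; simpl in G. lra.
Qed.

(** The product of [h] over the four quarter turns vanishes on every side of
    the square as soon as [h] vanishes on one. *)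
Lemma square_center_vanish (h : C -> C) (S : R) :
  0 < S ->
  (forall x y, Rabs x <= S -> Rabs y <= S -> cdiff h (x, y)) ->
  (forall x, Rabs x <= S -> h (x, - S) = 0%C) ->
  h 0%C = 0%C.
Proof.
  intros HS Hd Hbot.
  destruct (excluded_middle_informative (h 0%C = 0%C)) as [E|Hn]; [exact E|exfalso].
  set (P := fun w : C => ((/ (h 0 * h 0 * (h 0 * h 0)) + 0 * w) *
    (h (0 + 1 * w) * h (0 + Ci * w) * (h (0 + - (1) * w) * h (0 + - Ci * w))))%C).
  apply (rotation_invariant_vanish P S HS).
  - intros x y Hx Hy.
    unfold P. apply cdiff_mult; [apply cdiff_affine|].
    apply cdiff_mult; apply cdiff_mult; apply cdiff_comp_affine.
    + replace (0 + 1 * (x, y))%C with (x, y) by (apply injective_projections; simpl; ring).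
      now apply Hd.
    + replace (0 + Ci * (x, y))%C with (- y, x) by (apply injective_projections; simpl; ring).
      apply Hd; [now rewrite Rabs_Ropp | assumption].
    + replace (0 + - (1) * (x, y))%C with (- x, - y) by (apply injective_projections; simpl; ring).
      apply Hd; now rewrite Rabs_Ropp.
    + replace (0 + - Ci * (x, y))%C with (y, - x) by (apply injective_projections; simpl; ring).
      apply Hd; [assumption | now rewrite Rabs_Ropp].
  - intros w. unfold P.
    replace (0 + Ci * (Ci * w))%C with (0 + - (1) * w)%C
      by (apply injective_projections; simpl; ring).
    replace (0 + - Ci * (Ci * w))%C with (0 + 1 * w)%C
      by (apply injective_projections; simpl; ring).
    replace (0 + - (1) * (Ci * w))%C with (0 + - Ci * w)%C by ring.
    replace (0 + 1 * (Ci * w))%C with (0 + Ci * w)%C by ring.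
    ring.
  - intros x Hx. unfold P.
    replace (h (0 + 1 * (x, (- S)%R)))%C with (RtoC 0); [ring|].
    symmetry. replace (0 + 1 * (x, (- S)%R))%C with (x, - S)
      by (apply injective_projections; simpl; ring). now apply Hbot.
  - unfold P. replace (0 + 1 * 0)%C with (RtoC 0) by ring.
    replace (0 + Ci * 0)%C with (RtoC 0) by ring.
    replace (0 + - (1) * 0)%C with (RtoC 0) by ring.
    replace (0 + - Ci * 0)%C with (RtoC 0) by ring.
    field. exact Hn.
Qed.

(** * The complex exponential as a covering map *)

Definition cexp (z : C) : C := (exp (fst z) * cos (snd z), exp (fst z) * sin (snd z)).

Lemma cexp_plus (z w : C) : cexp (z + w)%C = (cexp z * cexp w)%C.
Proof.
  unfold cexp. simpl. rewrite exp_plus, cos_plus, sin_plus.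
  apply injective_projections; simpl; ring.
Qed.

Lemma Cmod_cexp z : Cmod (cexp z) = exp (fst z).
Proof.
  unfold Cmod, cexp. simpl fst. simpl snd.
  replace ((exp (fst z) * cos (snd z)) ^ 2 + (exp (fst z) * sin (snd z)) ^ 2)
    with (exp (fst z) ^ 2).
  - apply sqrt_pow2. left. apply exp_pos.
  - pose proof (sin2_cos2 (snd z)) as H. unfold Rsqr in H.
    replace (exp (fst z) ^ 2) with (exp (fst z) ^ 2 * 1) by ring. rewrite <- H. ring.
Qed.

Lemma cexp_neq_0 z : cexp z <> 0%C.
Proof. apply Cmod_gt_0. rewrite Cmod_cexp. apply exp_pos. Qed.

Lemma cos_sin_2kPI (n : Z) : cos (2 * IZR n * PI) = 1 /\ sin (2 * IZR n * PI) = 0.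
Proof.
  assert (S0 : sin (IZR n * PI) = 0) by (apply sin_eq_0_1; now exists n).
  replace (2 * IZR n * PI) with (2 * (IZR n * PI)) by ring.
  rewrite cos_2a_sin, sin_2a, S0. split; ring.
Qed.

Lemma cexp_period (z : C) (n : Z) : cexp (z + (0, 2 * IZR n * PI)%R)%C = cexp z.
Proof.
  destruct (cos_sin_2kPI n) as [C1 S0].
  rewrite cexp_plus. unfold cexp at 2. simpl fst. simpl snd.
  rewrite exp_0, C1, S0. apply injective_projections; simpl; ring.
Qed.

Lemma cexp_eq (z w : C) : cexp z = cexp w -> exists n : Z, w = (z + (0, 2 * IZR n * PI)%R)%C.
Proof.
  intros E.
  assert (E1 : fst z = fst w).
  { apply exp_inv. rewrite <- !Cmod_cexp. now rewrite E. }
  unfold cexp in E. rewrite E1 in E. pose proof (exp_pos (fst w)) as P.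
  injection E as Ec Es.
  apply Rmult_eq_reg_l in Ec; [|lra]. apply Rmult_eq_reg_l in Es; [|lra].
  assert (C1 : cos (2 * ((snd w - snd z) / 2)) = 1).
  { replace (2 * ((snd w - snd z) / 2)) with (snd w - snd z) by field.
    rewrite cos_minus, Ec, Es. pose proof (sin2_cos2 (snd w)) as H. unfold Rsqr in H. lra. }
  rewrite cos_2a_sin in C1.
  assert (S0 : sin ((snd w - snd z) / 2) = 0) by nra.
  apply sin_eq_0_0 in S0. destruct S0 as [n Hn]. exists n.
  apply injective_projections; simpl; [lra|].
  replace (2 * IZR n * PI) with (2 * (IZR n * PI)) by ring. rewrite <- Hn. field.
Qed.

(** The argument is [acos] of the normalised real part, with the sign of the
    imaginary part. *)
Lemma cexp_surj (w : C) : w <> 0%C -> exists z, cexp z = w.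
Proof.
  intros Hw. pose proof (proj1 (Cmod_gt_0 w) Hw) as Hr.
  set (r := Cmod w) in *.
  assert (Hsq : r * r = fst w * fst w + snd w * snd w).
  { pose proof (Cmod2_alt w) as K. fold r in K. unfold Re, Im in K. lra. }
  set (u := fst w / r). set (v := snd w / r).
  assert (Huv : u * u + v * v = 1).
  { unfold u, v. field_simplify_eq; [|lra]. nra. }
  assert (Hfst : fst w = r * u) by (unfold u; field; lra).
  assert (Hsnd : snd w = r * v) by (unfold v; field; lra).
  assert (Hu : -1 <= u <= 1) by nra.
  assert (Hs : sqrt (1 - Rsqr u) = Rabs v).
  { rewrite <- sqrt_Rsqr_abs. f_equal. unfold Rsqr. lra. }
  destruct (Rle_dec 0 v) as [Hv|Hv].
  - exists (ln r, acos u). unfold cexp. simpl. rewrite exp_ln by exact Hr.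
    rewrite cos_acos, sin_acos, Hs, Rabs_right by lra.
    apply injective_projections; simpl; lra.
  - exists (ln r, - acos u). unfold cexp. simpl. rewrite exp_ln by exact Hr.
    rewrite cos_neg, sin_neg, cos_acos, sin_acos, Hs, Rabs_left by lra.
    apply injective_projections; simpl; lra.
Qed.

(** The principal branch, meaningful on the right half-plane only. *)
Definition clog (z : C) : C := (ln (fst z ^ 2 + snd z ^ 2) / 2, atan (snd z / fst z)).

Lemma cexp_clog z : 0 < fst z -> cexp (clog z) = z.
Proof.
  destruct z as [x y]. intros Hx. simpl in Hx. unfold cexp, clog. cbn [fst snd].
  set (n := x ^ 2 + y ^ 2). assert (Hn : 0 < n) by (unfold n; nra).
  rewrite cos_atan, sin_atan.
  set (r := exp (ln n / 2)). assert (Hr : 0 < r) by apply exp_pos.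
  assert (Hrr : r * r = n).
  { unfold r. rewrite <- exp_plus. replace (ln n / 2 + ln n / 2) with (ln n) by field.
    now apply exp_ln. }
  assert (Hs : sqrt (1 + Rsqr (y / x)) = r / x).
  { apply sqrt_lem_1.
    - pose proof (Rle_0_sqr (y / x)). lra.
    - apply Rlt_le, Rdiv_lt_0_compat; lra.
    - replace (r / x * (r / x)) with (r * r / (x * x)) by (unfold Rdiv; rewrite Rinv_mult; ring).
      rewrite Hrr. unfold n, Rsqr. field. lra. }
  rewrite Hs. clearbody r. apply injective_projections; cbn [fst snd]; field; lra.
Qed.

Lemma clog_1 : clog 1 = 0%C.
Proof.
  unfold clog. simpl. replace (1 * (1 * 1) + 0 * (0 * 1)) with 1 by ring.
  rewrite ln_1. unfold Rdiv. rewrite !Rmult_0_l, atan_0. reflexivity.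
Qed.

(** The converse of [cdiff_closed_form] at a point; it gives the derivative of
    the logarithm from real derivatives. *)
Lemma cdiff_Cauchy_Riemann (f : C -> C) (x y A B : R) :
  differentiable_pt_lim (fun a b => fst (f (a, b))) x y A (- B) ->
  differentiable_pt_lim (fun a b => snd (f (a, b))) x y B A ->
  cdiff f (x, y).
Proof.
  intros Hu Hv. apply ex_derive_iff_cdiff. exists (A, B). split; [apply is_linear_scal_l|].
  intros z0 Hz0.
  rewrite <- (is_filter_lim_locally_unique (V := AbsRing_NormedModule C_AbsRing) (x, y) z0 Hz0).
  clear z0 Hz0. intros eps.
  assert (He : 0 < eps / 2) by (pose proof (cond_pos eps); lra).
  specialize (Hu (mkposreal _ He)). specialize (Hv (mkposreal _ He)).
  apply locally_2d_locally in Hu. apply locally_2d_locally in Hv.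
  apply (locally_C (x, y)).
  generalize (filter_and _ _ Hu Hv). apply filter_imp. clear Hu Hv.
  intros [a b] [h1 h2]. simpl in h1, h2.
  change (Cmod (f (a, b) - f (x, y) - ((a, b) - (x, y)) * (A, B))%C
          <= eps * Cmod ((a, b) - (x, y))%C).
  pose proof (Rmax_Cmod ((a, b) - (x, y))%C) as M. 
  change (Rmax (Rabs (a - x)) (Rabs (b - y)) <= Cmod ((a, b) - (x, y))%C) in M.
  set (m := Cmod ((a, b) - (x, y))%C) in *.
  set (e := (f (a, b) - f (x, y) - ((a, b) - (x, y)) * (A, B))%C).
  assert (T1 : Cmod e <= Rabs (fst e) + Rabs (snd e)).
  { replace e with (RtoC (fst e) + Ci * RtoC (snd e))%C at 1
      by (apply injective_projections; simpl; ring).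
    eapply Rle_trans; [apply Cmod_triangle|].
    rewrite Cmod_mult, Cmod_Ci, !Cmod_R. lra. }
  replace (fst (f (a, b)) - _ - _) with (fst e) in h1 by (unfold e; simpl; ring).
  replace (snd (f (a, b)) - _ - _) with (snd e) in h2 by (unfold e; simpl; ring).
  nra.
Qed.

Lemma cdiff_clog_1 : cdiff clog 1.
Proof.
  assert (Lpos : locally (T := prod_UniformSpace R_UniformSpace R_UniformSpace) (1, 0)
            (fun z : R * R => 0 < fst z)).
  { exists (mkposreal _ Rlt_0_1). intros [a b] [h _]. simpl.
    change (Rabs (a - 1) < 1) in h. apply Rabs_def2 in h. lra. }
  apply (cdiff_Cauchy_Riemann clog 1 0 1 0); apply filterdiff_differentiable_pt_lim.
  - replace (- 0) with 0 by ring.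
    eapply filterdiff_ext_lin.
    + apply (is_derive_filterdiff (fun a b => fst (clog (a, b))) 1 0
               (fun a b => a / (a ^ 2 + b ^ 2)) 0).
      * revert Lpos. apply filter_imp. intros [a b] Ha. simpl in Ha |- *.
        auto_derive; [nra | field; nra].
      * unfold clog. simpl. auto_derive; [lra | field].
      * apply continuous_Rdiv; simpl; [| | lra].
        -- apply continuous_fst.
        -- apply continuous_Rplus; repeat apply continuous_Rmult; try apply continuous_const;
             apply continuous_fst || apply continuous_snd.
    + intros [a b]. unfold plus, scal; simpl; unfold mult; simpl. field.
  - eapply filterdiff_ext_lin.
    + apply (is_derive_filterdiff (fun a b => snd (clog (a, b))) 1 0
               (fun a b => - b / (a ^ 2 + b ^ 2)) 1).
      * revert Lpos. apply filter_imp. intros [a b] Ha. simpl in Ha |- *.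
        unfold clog; simpl. auto_derive; [lra | field; nra].
      * unfold clog. simpl. auto_derive; [easy | field].
      * apply continuous_Rdiv; simpl; [| | lra].
        -- apply (continuous_opp (V := R_NormedModule)), continuous_snd.
        -- apply continuous_Rplus; repeat apply continuous_Rmult; try apply continuous_const;
             apply continuous_fst || apply continuous_snd.
    + intros [a b]. unfold plus, scal; simpl; unfold mult; simpl. field.
Qed.

(** The value of [F] at [w] is that of [G] at any logarithm of [w].  Near
    [cexp z] one of these is [z + clog (w / cexp z)], so that differentiability
    of [clog] at [1] is enough. *)
Lemma descend_along_cexp (G : C -> C) (eta : R) :
  (forall z, Rabs (fst z) < eta -> cdiff G z) ->
  (forall z (n : Z), Rabs (fst z) < eta -> G (z + (0, 2 * IZR n * PI)%R)%C = G z) ->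
  exists F : C -> C, forall z, Rabs (fst z) < eta -> F (cexp z) = G z /\ cdiff F (cexp z).
Proof.
  intros HG Hper.
  set (F := fun w => G (epsilon (inhabits (RtoC 0)) (fun z => cexp z = w))).
  assert (HF : forall z, Rabs (fst z) < eta -> F (cexp z) = G z).
  { intros z Hz. unfold F.
    pose proof (epsilon_spec (inhabits (RtoC 0)) (fun z' => cexp z' = cexp z)
                  (ex_intro _ z eq_refl)) as E.
    simpl in E. symmetry in E. destruct (cexp_eq _ _ E) as [n ->]. now apply Hper. }
  exists F. intros z Hz. split; [now apply HF|].
  assert (Hlog : cdiff (fun w => z + 1 * clog (0 + / cexp z * w))%C (cexp z)).
  { assert (E1 : (0 + / cexp z * cexp z)%C = 1%C) by (field; apply cexp_neq_0).
    apply (cdiff_comp (fun w => z + 1 * w)%C (fun w => clog (0 + / cexp z * w))%C).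
    - apply cdiff_comp_affine. rewrite E1. apply cdiff_clog_1.
    - apply cdiff_affine. }
  assert (Hval : (z + 1 * clog (0 + / cexp z * cexp z))%C = z).
  { replace (0 + / cexp z * cexp z)%C with (RtoC 1) by (field; apply cexp_neq_0).
    rewrite clog_1. ring. }
  apply (cdiff_ext_loc (fun w => G (z + 1 * clog (0 + / cexp z * w))%C)).
  - pose proof (cdiff_continuous _ _ Hlog) as C1.
    assert (C2 : continuous (T := C_UniformSpace) (U := C_UniformSpace)
                   (fun w => 0 + / cexp z * w)%C (cexp z))
      by apply cdiff_continuous, cdiff_affine.
    assert (L1 : locally (T := C_UniformSpace) (cexp z)
       (fun w => Rabs (fst (z + 1 * clog (0 + / cexp z * w))%C) < eta)).
    { apply continuous_Re in C1.
      assert (Hd : 0 < eta - Rabs (fst z)) by lra.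
      apply (proj1 (filterlim_locally _ _)) with (eps := mkposreal _ Hd) in C1.
      revert C1. apply filter_imp. intros w Hw. rewrite Hval in Hw.
      set (t := fst (z + 1 * clog (0 + / cexp z * w))%C) in *.
      change (Rabs (t - fst z) < eta - Rabs (fst z)) in Hw.
      pose proof (Rabs_triang (t - fst z) (fst z)) as K.
      replace (t - fst z + fst z) with t in K by ring. lra. }
    assert (L2 : locally (T := C_UniformSpace) (cexp z)
       (fun w => 0 < fst (0 + / cexp z * w)%C)).
    { apply continuous_Re in C2.
      apply (proj1 (filterlim_locally _ _)) with (eps := mkposreal _ Rlt_0_1) in C2.
      revert C2. apply filter_imp. intros w Hw.
      replace (0 + / cexp z * cexp z)%C with (RtoC 1) in Hw by (field; apply cexp_neq_0).
      set (t := fst (0 + / cexp z * w)%C) in *.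
      change (Rabs (t - 1) < 1) in Hw. apply Rabs_def2 in Hw. lra. }
    generalize (filter_and _ _ L1 L2). apply filter_imp. intros w [h1 h2].
    rewrite <- HF by exact h1. f_equal.
    rewrite cexp_plus. replace (1 * clog (0 + / cexp z * w))%C with (clog (0 + / cexp z * w)) by ring.
    rewrite cexp_clog by exact h2. field. apply cexp_neq_0.
  - apply (cdiff_comp G _ _ Hlog). rewrite Hval. now apply HG.
Qed.

(** * Holomorphic extension of the curve to a strip *)

(** The square of half-width [|y|] centred at [(s, y)] has a side on the real
    axis.  The factor [e], the sign of [y], turns it so that this is the
    bottom side. *)
Lemma identity_near_axis (f g : C -> C) (s y : R) :
  (forall x' y', Rabs (x' - s) <= Rabs y -> Rabs y' <= 2 * Rabs y ->
     cdiff f (x', y') /\ cdiff g (x', y')) ->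
  (forall x', Rabs (x' - s) <= Rabs y -> f (x', 0) = g (x', 0)) ->
  f (s, y) = g (s, y).
Proof.
  intros Hd Hax.
  destruct (Req_dec y 0) as [->|Hy].
  { apply Hax. rewrite Rminus_diag. lra. }
  set (e := y / Rabs y).
  assert (HS : 0 < Rabs y) by now apply Rabs_pos_lt.
  assert (He : e * e = 1).
  { unfold e. transitivity ((y * y) / (Rabs y * Rabs y)); [field; lra|].
    rewrite <- Rabs_mult. rewrite Rabs_right by nra. field. lra. }
  assert (Hey : e * Rabs y = y) by (unfold e; field; lra).
  assert (Hae : Rabs e = 1).
  { unfold e. rewrite Rabs_div, Rabs_Rabsolu by lra. field. lra. }
  assert (K : forall a b, ((s, y) + RtoC e * (a, b))%C = (s + e * a, y + e * b)).
  { intros a b. apply injective_projections; simpl; ring. }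
  assert (V : (f ((s, y) + RtoC e * 0) - g ((s, y) + RtoC e * 0))%C = 0%C).
  { apply (square_center_vanish (fun w => f ((s, y) + RtoC e * w) - g ((s, y) + RtoC e * w))%C
             (Rabs y) HS).
    - intros a b Ha Hb.
      assert (B1 : Rabs (s + e * a - s) <= Rabs y).
      { replace (s + e * a - s) with (e * a) by ring. rewrite Rabs_mult, Hae. lra. }
      assert (B2 : Rabs (y + e * b) <= 2 * Rabs y).
      { eapply Rle_trans; [apply Rabs_triang|]. rewrite Rabs_mult, Hae. lra. }
      apply cdiff_minus; apply cdiff_comp_affine; rewrite K; now apply Hd.
    - intros a Ha. rewrite K.
      replace (y + e * - Rabs y) with 0 by (rewrite <- Hey at 1; ring).
      rewrite Hax; [ring|].
      replace (s + e * a - s) with (e * a) by ring. rewrite Rabs_mult, Hae. lra. }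
  replace ((s, y) + RtoC e * 0)%C with ((s, y) : C) in V
    by (apply injective_projections; simpl; ring).
  now apply Cminus_eq_0.
Qed.

Definition near_axis (t r : R) (z : C) : Prop := Rabs (fst z - t) < r /\ Rabs (snd z) < r.

Definition conformal_extension (g : R -> C) (t r : R) (phi : C -> C) : Prop :=
  (forall z, near_axis t r z -> cdiff phi z) /\
  injective_on (near_axis t r) phi /\
  (forall s, Rabs (s - t) < r -> phi (s, 0) = g s).

Lemma locally_analytic_extension g t :
  locally_analytic_curve g -> exists (r : posreal) phi, conformal_extension g t r phi.
Proof.
  intros [_ H]. destruct (H t) as (a & b & Hab & _ & _ & V & phi & HV & HabV & [Hh Hi] & Hphi).
  destruct (HV (RtoC t)) as [e He]; [apply HabV; lra|].
  assert (Hr : 0 < Rmin e (Rmin (t - a) (b - t))).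
  { pose proof (cond_pos e). repeat apply Rmin_pos; lra. }
  exists (mkposreal _ Hr), phi. cbn [pos].
  pose proof (Rmin_l e (Rmin (t - a) (b - t))). pose proof (Rmin_r e (Rmin (t - a) (b - t))).
  pose proof (Rmin_l (t - a) (b - t)). pose proof (Rmin_r (t - a) (b - t)).
  assert (HVz : forall z, near_axis t (Rmin e (Rmin (t - a) (b - t))) z -> V z).
  { intros [x y] [h1 h2]. apply He. simpl in h1, h2. split.
    - change (Rabs (x - t) < e). lra.
    - change (Rabs (y - 0) < e). rewrite Rminus_0_r. lra. }
  split; [|split].
  - intros z Hz. apply ex_derive_iff_cdiff, Hh. auto.
  - intros z w Hz Hw. apply Hi; auto.
  - intros s Hs. apply Rabs_def2 in Hs. apply (Hphi s). lra.
Qed.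

(** A local extension serves all nearby points with a smaller radius; this is
    what gives a common radius by compactness. *)
Lemma conformal_extension_mono g t t' r r' phi :
  Rabs (t' - t) + r' <= r -> conformal_extension g t r phi -> conformal_extension g t' r' phi.
Proof.
  intros Hr (H1 & H2 & H3).
  assert (Tr : forall x, Rabs (x - t') < r' -> Rabs (x - t) < r).
  { intros x Hx. replace (x - t) with (x - t' + (t' - t)) by ring.
    eapply Rle_lt_trans; [apply Rabs_triang|]. lra. }
  assert (M : forall z, near_axis t' r' z -> near_axis t r z).
  { intros z [a b]. split; [now apply Tr|]. pose proof (Rabs_pos (t' - t)). lra. }
  split; [|split]; auto.
  intros z w Hz Hw. apply H2; auto.
Qed.

Lemma periodic_Z (g : R -> C) T : (forall t, g (t + T) = g t) ->
  forall (n : Z) t, g (t + IZR n * T) = g t.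
Proof.
  intros Hp. assert (N : forall (n : nat) t, g (t + INR n * T) = g t).
  { induction n as [|n IH]; intros t.
    - simpl. f_equal. ring.
    - rewrite S_INR. replace (t + (INR n + 1) * T) with ((t + INR n * T) + T) by ring.
      now rewrite Hp. }
  intros n t. destruct (Z_le_dec 0 n) as [Hn|Hn].
  - rewrite <- (Z2Nat.id n Hn), <- INR_IZR_INZ. apply N.
  - rewrite <- (N (Z.to_nat (- n)) (t + IZR n * T)).
    rewrite INR_IZR_INZ, Z2Nat.id by lia. rewrite opp_IZR. f_equal. ring.
Qed.

Lemma mod_period T t : 0 < T -> exists n : Z, 0 <= t - IZR n * T < T.
Proof.
  intros HT. exists (Int_part (t / T)).
  destruct (base_Int_part (t / T)) as [h1 h2].
  set (n := IZR (Int_part (t / T))) in *.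
  assert (E : t = t / T * T) by (field; lra). set (q := t / T) in *. nra.
Qed.

Lemma conformal_extension_shift g T (n : Z) t r phi :
  (forall t, g (t + T) = g t) ->
  conformal_extension g (t - IZR n * T) r phi ->
  conformal_extension g t r (fun z => phi (RtoC (- (IZR n * T)) + 1 * z)%C).
Proof.
  intros Hp (H1 & H2 & H3).
  assert (M : forall z, near_axis t r z ->
     near_axis (t - IZR n * T) r (RtoC (- (IZR n * T)) + 1 * z)%C).
  { intros [x y] [a b]. simpl in a, b. split; simpl.
    - replace (_ - _) with (x - t) by ring. exact a.
    - replace (0 + _) with y by ring. exact b. }
  split; [|split].
  - intros z Hz. apply cdiff_comp_affine. auto.
  - intros z w Hz Hw E. apply H2 in E; auto.
    replace z with (RtoC (IZR n * T) + (RtoC (- (IZR n * T)) + 1 * z))%C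
      by (apply injective_projections; simpl; ring).
    rewrite E. apply injective_projections; simpl; ring.
  - intros s Hs. replace (RtoC (- (IZR n * T)) + 1 * (s, 0%R))%C with (s - IZR n * T, 0)
      by (apply injective_projections; simpl; ring).
    rewrite H3.
    + rewrite <- (periodic_Z g T Hp n). f_equal. ring.
    + replace (_ - _) with (s - t) by ring. exact Hs.
Qed.

Lemma uniform_extension g T : 0 < T -> (forall t, g (t + T) = g t) ->
  locally_analytic_curve g ->
  exists (r : posreal) (Phi : R -> C -> C), forall t, conformal_extension g t r (Phi t).
Proof.
  intros HT Hp Hg.
  set (Q := fun t (r : posreal) => exists phi, conformal_extension g t r phi).
  set (rad := fun t => epsilon (inhabits (mkposreal _ Rlt_0_1)) (Q t)).
  assert (Hrad : forall t, exists phi, conformal_extension g t (rad t) phi).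
  { intros t. apply (epsilon_spec (inhabits (mkposreal _ Rlt_0_1)) (Q t)).
    now apply locally_analytic_extension. }
  destruct (compactness_value_1d 0 T (fun t => pos_div_2 (rad t))) as [d Hd].
  exists d.
  assert (Ex : forall t, exists phi, conformal_extension g t d phi).
  { intros t. destruct (mod_period T t HT) as [n Hn].
    destruct (NNPP _ (Hd (t - IZR n * T) ltac:(lra))) as (u & Hu & h1 & h2).
    destruct (Hrad u) as [phi Hphi]. simpl in h1, h2.
    eexists. apply (conformal_extension_shift g T n); [exact Hp|].
    eapply conformal_extension_mono; [| exact Hphi]. lra. }
  exists (fun t => epsilon (inhabits (fun z => z)) (fun phi => conformal_extension g t d phi)).
  intros t. exact (epsilon_spec _ _ (Ex t)).
Qed.

(** With [r] the common radius, the strip has half-width [r / 4]: the square on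
    which [identity_near_axis] compares [Phi s] and [Phi t] has height at most
    [2 * (r / 4)] and stays within [r] of both [s] and [t] when
    [|s - t| < r / 4].  Periodicity is the same comparison, between [Phi s] and
    the translate of [Phi (s + n T)].  The last clause is injectivity of a
    single [Phi s]. *)
Lemma strip_extension g T : 0 < T -> (forall t, g (t + T) = g t) ->
  locally_analytic_curve g ->
  exists (eta : posreal) (G : C -> C),
    (forall z, Rabs (snd z) < eta -> cdiff G z) /\
    (forall t, G (t, 0) = g t) /\
    (forall z (n : Z), Rabs (snd z) < eta -> G (z + RtoC (IZR n * T))%C = G z) /\
    (forall z w, Rabs (snd z) < eta -> Rabs (snd w) < eta -> Rabs (fst w - fst z) < eta ->
       G z = G w -> z = w).
Proof.
  intros HT Hp Hg. destruct (uniform_extension g T HT Hp Hg) as (r & Phi & HPhi).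
  pose proof (cond_pos r) as Hr.
  assert (Hagree : forall s t y, Rabs (s - t) < r / 4 -> Rabs y < r / 4 ->
             Phi t (s, y) = Phi s (s, y)).
  { intros s t y Hst Hy. destruct (HPhi t) as (A1 & _ & A3). destruct (HPhi s) as (B1 & _ & B3).
    assert (Tr : forall x', Rabs (x' - s) <= Rabs y -> Rabs (x' - t) < r /\ Rabs (x' - s) < r).
    { intros x' Hx'. split; [|lra]. replace (x' - t) with (x' - s + (s - t)) by ring.
      eapply Rle_lt_trans; [apply Rabs_triang|]. lra. }
    apply identity_near_axis.
    - intros x' y' Hx' Hy'. destruct (Tr x' Hx').
      split; [apply A1 | apply B1]; split; simpl; lra.
    - intros x' Hx'. destruct (Tr x' Hx'). rewrite A3, B3 by lra. reflexivity. }
  assert (He : 0 < r / 4) by lra.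
  exists (mkposreal _ He), (fun z => Phi (fst z) z). cbn [pos].
  split; [|split; [|split]].
  - intros [s y] Hy. simpl in Hy.
    apply (cdiff_ext_loc (Phi s)).
    + assert (Hd : 0 < Rmin (r / 4) (r / 4 - Rabs y)) by (apply Rmin_pos; lra).
      pose proof (Rmin_l (r / 4) (r / 4 - Rabs y)). pose proof (Rmin_r (r / 4) (r / 4 - Rabs y)).
      exists (mkposreal _ Hd). intros [s' y'] [h1 h2]. simpl.
      change (Rabs (s' - s) < Rmin (r / 4) (r / 4 - Rabs y)) in h1.
      change (Rabs (y' - y) < Rmin (r / 4) (r / 4 - Rabs y)) in h2.
      apply Hagree; [lra|].
      replace y' with (y' - y + y) by ring.
      eapply Rle_lt_trans; [apply Rabs_triang|]. lra.
    + apply (HPhi s). split; simpl; [rewrite Rminus_diag, Rabs_R0; lra | lra].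
  - intros t. simpl. apply (HPhi t). rewrite Rminus_diag, Rabs_R0. lra.
  - intros [s y] n Hy. simpl in Hy |- *.
    replace ((s, y) + RtoC (IZR n * T))%C with (RtoC (IZR n * T) + 1 * (s, y))%C by ring.
    pose proof (conformal_extension_shift g T (- n) s r (Phi (s + IZR n * T)) Hp) as Sh.
    rewrite opp_IZR in Sh.
    replace (s - - IZR n * T) with (s + IZR n * T) in Sh by ring.
    replace (- (- IZR n * T)) with (IZR n * T) in Sh by ring.
    destruct (Sh (HPhi _)) as (A1 & _ & A3). destruct (HPhi s) as (B1 & _ & B3).
    apply (identity_near_axis (fun z => Phi (s + IZR n * T) (RtoC (IZR n * T) + 1 * z)%C)).
    + intros x' y' Hx' Hy'. split; [apply A1 | apply B1]; split; simpl; lra.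
    + intros x' Hx'. rewrite A3, B3 by lra. reflexivity.
  - intros [s y] [t x]. simpl. intros Hy Hx Hst E.
    rewrite <- (Hagree t s x Hst Hx) in E.
    apply (HPhi s); [| | exact E]; split; simpl; try lra.
    rewrite Rminus_diag, Rabs_R0. lra.
Qed.

Lemma separated_values (f : C -> R) (z w : C) :
  continuous (T := C_UniformSpace) f z -> continuous (T := C_UniformSpace) f w -> f z <> f w ->
  exists e : posreal, forall z' w' : C,
    ball (M := C_UniformSpace) z e z' -> ball (M := C_UniformSpace) w e w' -> f z' <> f w'.
Proof.
  intros Cz Cw Hn.
  assert (Hd : 0 < Rabs (f z - f w) / 2) by (pose proof (Rabs_pos_lt (f z - f w)); lra).
  apply (proj1 (filterlim_locally _ _)) with (eps := mkposreal _ Hd) in Cz.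
  apply (proj1 (filterlim_locally _ _)) with (eps := mkposreal _ Hd) in Cw.
  destruct Cz as [e1 H1], Cw as [e2 H2].
  assert (He : 0 < Rmin e1 e2) by (apply Rmin_pos; apply cond_pos).
  exists (mkposreal _ He). intros z' w' Hz' Hw' E. simpl in Hz', Hw'.
  specialize (H1 z' (ball_le _ _ _ (Rmin_l e1 e2) _ Hz')).
  specialize (H2 w' (ball_le _ _ _ (Rmin_r e1 e2) _ Hw')).
  change (Rabs (f z' - f z) < Rabs (f z - f w) / 2) in H1.
  change (Rabs (f w' - f w) < Rabs (f z - f w) / 2) in H2.
  rewrite E in H1. revert H1 H2. unfold Rabs. repeat destruct Rcase_abs; lra.
Qed.

Lemma ball_near_axis t r z : near_axis t r z -> ball (M := C_UniformSpace) ((t, 0) : C) r z.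
Proof.
  destruct z as [x y]. intros [h1 h2]. split; [exact h1|].
  change (Rabs (y - 0) < r). now rewrite Rminus_0_r.
Qed.

(** Every pair [(s, t)] of points of a period has neighbourhoods on which the
    conclusion holds: if [t - s] is a multiple of [T], translate by it and use
    injectivity of [G] on small squares; if not, [g s] and [g t] are distinct
    and [G] keeps them apart.  A Lebesgue number of this covering of
    [[0, T] x [0, T]] is the required half-width. *)
Lemma injective_modulo_period g T (eta : posreal) (G : C -> C) :
  Jordan_curve T g ->
  (forall z, Rabs (snd z) < eta -> cdiff G z) ->
  (forall t, G (t, 0) = g t) ->
  (forall z (n : Z), Rabs (snd z) < eta -> G (z + RtoC (IZR n * T))%C = G z) ->
  (forall z w, Rabs (snd z) < eta -> Rabs (snd w) < eta -> Rabs (fst w - fst z) < eta ->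
     G z = G w -> z = w) ->
  exists d : posreal, d <= eta /\ forall z w, Rabs (snd z) < d -> Rabs (snd w) < d -> G z = G w ->
    exists n : Z, w = (z + RtoC (IZR n * T))%C.
Proof.
  intros (HT & _ & Hp & Hinj) Hd Hval Hper Hloc. pose proof (cond_pos eta) as He.
  set (Q := fun s t (e : posreal) => e <= eta /\
    forall z w, near_axis s e z -> near_axis t e w -> G z = G w ->
      exists n : Z, w = (z + RtoC (IZR n * T))%C).
  assert (Hpair : forall s t, 0 <= s <= T -> 0 <= t <= T -> exists e, Q s t e).
  { intros s t Hs Ht.
    destruct (excluded_middle_informative (exists n : Z, t = s + IZR n * T)) as [[n Hn]|Hno].
    - assert (He2 : 0 < eta / 2) by lra. exists (mkposreal _ He2). split; [simpl; lra|].
      cbn [pos]. intros [x y] [x' y'] [a1 a2] [b1 b2] E. simpl in a1, a2, b1, b2.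
      exists n. replace ((x', y') : C) with (((x' - IZR n * T)%R, y') + RtoC (IZR n * T))%C
        by (apply injective_projections; simpl; ring).
      f_equal. symmetry. apply Hloc; simpl; [lra | lra | |].
      + replace (x' - IZR n * T - x) with ((x' - t) - (x - s)) by (rewrite Hn; ring).
        eapply Rle_lt_trans; [apply Rabs_triang|]. rewrite Rabs_Ropp. lra.
      + rewrite E. rewrite <- (Hper (x' - IZR n * T, y') n) by (simpl; lra).
        f_equal. apply injective_projections; simpl; ring.
    - assert (Hne : G (s, 0) <> G (t, 0)).
      { rewrite !Hval. intros E. apply Hno.
        assert (Hmod : forall u, 0 <= u <= T -> exists (m : Z) u', u = u' + IZR m * T /\ 0 <= u' < T).
        { intros u Hu. destruct (mod_period T u HT) as [m Hm].
          exists m, (u - IZR m * T). split; [ring | exact Hm]. }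
        destruct (Hmod s Hs) as (m & s' & Es & Hs'). destruct (Hmod t Ht) as (m' & t' & Et & Ht').
        exists (m' - m)%Z. rewrite minus_IZR.
        rewrite Es, Et, !(periodic_Z g T Hp) in E. apply Hinj in E; [| exact Hs' | exact Ht'].
        rewrite Et, Es, E. ring. }
      assert (HC : forall u, continuous (T := C_UniformSpace) (U := C_UniformSpace) G (u, 0)).
      { intros u. apply cdiff_continuous, Hd. simpl. rewrite Rabs_R0. exact He. }
      assert (Hsep : exists e : posreal, forall z' w' : C,
        ball (M := C_UniformSpace) ((s, 0) : C) e z' ->
        ball (M := C_UniformSpace) ((t, 0) : C) e w' -> G z' <> G w').
      { destruct (Req_dec (fst (G (s, 0))) (fst (G (t, 0)))) as [E1|N1].
        - destruct (Req_dec (snd (G (s, 0))) (snd (G (t, 0)))) as [E2|N2].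
          + exfalso. apply Hne. now apply injective_projections.
          + destruct (separated_values (fun z => snd (G z)) (s, 0) (t, 0)) as [e Hsep];
              [now apply continuous_Im.. | exact N2 |].
            exists e. intros z' w' h1 h2 E. apply (Hsep z' w' h1 h2). now rewrite E.
        - destruct (separated_values (fun z => fst (G z)) (s, 0) (t, 0)) as [e Hsep];
            [now apply continuous_Re.. | exact N1 |].
          exists e. intros z' w' h1 h2 E. apply (Hsep z' w' h1 h2). now rewrite E. }
      destruct Hsep as [e Hsep].
      assert (Hm : 0 < Rmin e eta) by (apply Rmin_pos; apply cond_pos).
      exists (mkposreal _ Hm). split; [apply Rmin_r|]. cbn [pos].
      intros z w Hz Hw E. exfalso.
      apply (Hsep z w); [| | exact E];
        (eapply ball_le; [apply (Rmin_l e eta)|]; now apply ball_near_axis). }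
  set (delta := fun s t => epsilon (inhabits eta) (Q s t)).
  destruct (compactness_value_2d 0 T 0 T delta) as [d0 Hd0].
  assert (Hm : 0 < Rmin d0 eta) by (apply Rmin_pos; apply cond_pos).
  exists (mkposreal _ Hm). cbn [pos]. split; [apply Rmin_r|].
  intros z w Hz Hw E.
  pose proof (Rmin_l d0 eta) as M1. pose proof (Rmin_r d0 eta) as M2.
  destruct (mod_period T (fst z) HT) as [m Hzm]. destruct (mod_period T (fst w) HT) as [m' Hwm].
  destruct (NNPP _ (Hd0 (fst z - IZR m * T) (fst w - IZR m' * T) ltac:(lra) ltac:(lra)))
    as (s & t & Hs & Ht & h1 & h2 & h3).
  destruct (epsilon_spec (inhabits eta) (Q s t) (Hpair s t Hs Ht)) as [_ Hst].
  fold (delta s t) in Hst.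
  destruct (Hst ((fst z - IZR m * T)%R, snd z) ((fst w - IZR m' * T)%R, snd w)) as [n Hn].
  - split; simpl; lra.
  - split; simpl; lra.
  - rewrite <- (Hper ((fst z - IZR m * T)%R, snd z) m), <- (Hper ((fst w - IZR m' * T)%R, snd w) m')
      by (simpl; lra).
    replace (((fst z - IZR m * T)%R, snd z) + RtoC (IZR m * T))%C with z
      by (apply injective_projections; simpl; ring).
    replace (((fst w - IZR m' * T)%R, snd w) + RtoC (IZR m' * T))%C with w
      by (apply injective_projections; simpl; ring).
    exact E.
  - exists (n - m + m')%Z. rewrite plus_IZR, minus_IZR.
    pose proof (f_equal fst Hn) as F1. pose proof (f_equal snd Hn) as F2. simpl in F1, F2.
    apply injective_projections; simpl; lra.
Qed.

Theorem theorem2p6 (T : R) (gamma : R -> C)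
  (Hjordan : Jordan_curve T gamma)
  (Hanalytic : locally_analytic_curve gamma) :
  analytic_Jordan_curve gamma.
Proof.
  pose proof Hjordan as (HT & _ & Hp & _).
  destruct (strip_extension gamma T HT Hp Hanalytic) as (eta & G & Hd & Hval & Hper & Hloc).
  destruct (injective_modulo_period gamma T eta G Hjordan Hd Hval Hper Hloc) as (d & Hde & Hinj).
  pose proof (cond_pos d) as Hdp. pose proof PI_RGT_0 as HPI.
  set (tau := T / (2 * PI)).
  assert (Htau : 0 < tau) by (apply Rdiv_lt_0_compat; lra).
  assert (HtauT : tau * (2 * PI) = T) by (unfold tau; field; lra).
  (* [z = lam * zeta] is the inverse of [zeta = 2 pi i z / T]. *)
  set (lam := ((0, - tau) : C)).
  assert (Hlam : forall x y, (0 + lam * (x, y))%C = (tau * y, - tau * x)).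
  { intros x y. apply injective_projections; simpl; ring. }
  set (rho := d / tau). assert (Hrho : 0 < rho) by (apply Rdiv_lt_0_compat; lra).
  assert (Hbd : forall z : C, Rabs (fst z) < rho -> Rabs (snd (0 + lam * z)%C) < d).
  { intros [x y] Hx. rewrite Hlam. simpl in *.
    replace (- tau * x) with (- (tau * x)) by ring.
    rewrite Rabs_Ropp, Rabs_mult, (Rabs_right tau) by lra.
    replace (pos d) with (tau * rho) by (unfold rho; field; lra). nra. }
  assert (Hsh : forall (z : C) (n : Z), (0 + lam * (z + (0, 2 * IZR n * PI)%R))%C
                  = ((0 + lam * z) + RtoC (IZR n * T))%C).
  { intros z n. rewrite <- HtauT. apply injective_projections; simpl; ring. }
  destruct (descend_along_cexp (fun z => G (0 + lam * z)%C) rho) as [F HF].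
  { intros z Hz. apply cdiff_comp_affine, Hd. specialize (Hbd z Hz). lra. }
  { intros z n Hz. rewrite Hsh. apply Hper. specialize (Hbd z Hz). lra. }
  assert (Hann : forall w, annulus (exp (- rho)) (exp rho) w ->
            exists z, cexp z = w /\ Rabs (fst z) < rho).
  { intros w [h1 h2]. destruct (cexp_surj w) as [z Hz].
    - apply Cmod_gt_0. pose proof (exp_pos (- rho)). lra.
    - exists z. split; [exact Hz|]. rewrite <- Hz, Cmod_cexp in h1, h2.
      apply exp_lt_inv in h1. apply exp_lt_inv in h2. apply Rabs_def1; lra. }
  exists (exp (- rho)), (exp rho), F.
  split; [|split; [|split; [split|]]].
  - split; [apply exp_pos|]. rewrite <- exp_0. apply exp_increasing. lra.
  - rewrite <- exp_0. apply exp_increasing. lra.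
  - intros w Hw. destruct (Hann w Hw) as (z & <- & Hz).
    apply ex_derive_iff_cdiff, HF, Hz.
  - intros w w' Hw Hw' E.
    destruct (Hann w Hw) as (z & <- & Hz). destruct (Hann w' Hw') as (z' & <- & Hz').
    rewrite (proj1 (HF z Hz)), (proj1 (HF z' Hz')) in E.
    destruct (Hinj _ _ (Hbd z Hz) (Hbd z' Hz') E) as [n Hn].
    rewrite <- Hsh in Hn. rewrite <- (cexp_period z n). f_equal. symmetry.
    destruct z as [x y], z' as [x' y'].
    pose proof (f_equal fst Hn) as F1. pose proof (f_equal snd Hn) as F2.
    simpl in F1, F2. apply injective_projections; simpl; apply (Rmult_eq_reg_l tau); lra.
  - intros w. split.
    + intros [t <-]. exists (cexp (0, t / tau)). split.
      * rewrite Cmod_cexp. apply exp_0.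
      * rewrite (proj1 (HF (0, t / tau) ltac:(simpl; rewrite Rabs_R0; exact Hrho))).
        rewrite Hlam, <- Hval. f_equal. apply injective_projections; simpl; field; lra.
    + intros (w0 & Hmod & <-).
      destruct (cexp_surj w0) as [z Hz]; [apply Cmod_gt_0; lra|].
      rewrite <- Hz, Cmod_cexp, <- exp_0 in Hmod. apply exp_inv in Hmod.
      exists (tau * snd z). rewrite <- Hz.
      rewrite (proj1 (HF z ltac:(rewrite Hmod, Rabs_R0; exact Hrho))).
      rewrite <- Hval. destruct z as [x y]. simpl in Hmod. rewrite Hlam, Hmod.
      f_equal. apply injective_projections; simpl; ring.
Qed.
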